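(* Let $r\in[1,2)$, let $K(x_1,x_2)=-\|x_1-x_2\|_2^r$ on $\mathbb R^d\times\mathbb R^d$, and let $\eta^*$ be the unique minimizer of $$\min_{\eta\in\mathcal P_2(\mathbb R^d)}\mathcal E_K(\eta)\quad\text{subject to}\quad\int_{\mathbb R^d}\|x\|_2^2\,\mathrm d\eta(x)=1 .$$ Then the curve $\gamma:[0,\infty)\to\mathcal P_2(\mathbb R^d)$ given by $$\gamma(t)=(\alpha_t\,\mathrm{Id})_\#\eta^*,\qquad \alpha_t=\big(-t\,r(2-r)\,\mathcal E_K(\eta^* )\big)^{\frac1{2-r}},$$ is a Wasserstein steepest descent flow with respect to $\mathcal E_K$ starting at $\gamma(0)=\delta_0$.
   Context: **Basic notation.** $\mathcal P_2(\mathbb R^d)$ is the set of Borel probability measures on $\mathbb R^d$ with finite second moment, with the Wasserstein-2 distance $W_2$; $\Gamma^{\rm opt}(\mu,\nu)$ is the set of optimal transport plans for $W_2$. $T_\#\mu=\mu\circ T^{-1}$, $\pi_i,\pi_{i,j}$ denote projections onto components. The interaction energy is $\mathcal E_K(\mu)=\frac12\iint K(x_1,x_2)\,\mathrm d\mu(x_1)\mathrm d\mu(x_2)$. **Velocity plans and tangent space.** $V(\mu)=\{v\in\mathcal P_2(\mathbb R^d\times\mathbb R^d):(\pi_1)_\#v=\mu\}$, with metric $W_\mu^2(v,w)=\inf\int\|x_2-x_3\|_2^2\,\mathrm d\alpha(x_1,x_2,x_3)$, the infimum being over $\alpha\in\mathcal P_2((\mathbb R^d)^3)$ with $(\pi_{1,2})_\#\alpha=v$,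 $(\pi_{1,3})_\#\alpha=w$. For $c\in\mathbb R$, $c\cdot v=(\pi_1,c\,\pi_2)_\#v$; $0_\mu=\mu\otimes\delta_0$; $\gamma_v(t)=(\pi_1+t\pi_2)_\#v$, $t\ge0$. A geodesic is a curve with $W_2(\gamma(t_1),\gamma(t_2))=C|t_2-t_1|$ for a constant $C\ge0$. $G(\mu)$ is the set of $v\in V(\mu)$ such that $\gamma_v$ is a geodesic on $[0,\epsilon]$ for some $\epsilon>0$, and $\mathbf T_\mu$ (the geometric tangent space) is the closure of $G(\mu)$ in $(V(\mu),W_\mu)$. **Steepest descent directions.** For $\mathcal F:\mathcal P_2(\mathbb R^d)\to(-\infty,\infty]$, $\mathcal F(\mu)<\infty$ and $v\in\mathbf T_\mu$, $$\mathrm H_v^-\mathcal F(\mu)=\liminf\frac{\mathcal F(\gamma_w(t))-\mathcal F(\mu)}t,$$ the liminf being over $w\to v$ in $W_\mu$ and $t\to0+$ with $\gamma_w|_{[0,t]}$ a geodesic. The set of directions of steepest descent is $$\mathrm H_-\mathcal F(\mu)=\Big\{(\mathrm H_v^-\mathcal F(\mu))^-\cdot v:\ v\in\operatorname*{arg\,min}_{w\in\mathbf T_\mu,\ W_\mu(w,0_\mu)=1}\mathrm H_w^-\mathcal F(\mu)\Big\},\qquad (s)^-=\max\{-s,0\},$$ defined if $\mathrm H_v^-\mathcal F(\mu)\in(-\infty,\infty]$ for all $v\in\mathbf T_\mu$. **Tangent vectors and flows.** $\exp_\mu^{-1}(\nu)=\{(\pi_1,\pi_2-\pi_1)_\#\pi:\pi\in\Gamma^{\rm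 opt}(\mu,\nu)\}$. A plan $v_t\in\mathbf T_{\gamma(t)}$ is the tangent vector $\dot\gamma(t)$ of a curve $\gamma$ at $t$ if, for any choice $v_{t,h}\in\exp_{\gamma(t)}^{-1}(\gamma(t+h))$, $\lim_{h\to0+}W_{\gamma(t)}(v_t,\frac1h\cdot v_{t,h})=0$. A Wasserstein steepest descent flow with respect to $\mathcal F$ is a locally absolutely continuous curve $\gamma:[0,\infty)\to\mathcal P_2(\mathbb R^d)$ (locally $W_2(\gamma(s),\gamma(t))\le\int_s^tm$ with $m$ integrable) such that for all $t\in[0,\infty)$ the tangent vector $\dot\gamma(t)$ exists and $\dot\gamma(t)\in\mathrm H_-\mathcal F(\gamma(t))$. *)

(* Defs.v *)
From HB Require Import structures.
From mathcomp Require Import all_boot all_order all_algebra.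
From mathcomp Require Import all_classical all_reals all_analysis.
From mathcomp Require Import measurable_realfun giry.

Set Implicit Arguments.
Unset Strict Implicit.
Unset Printing Implicit Defensive.

Import Order.TTheory GRing.Theory Num.Theory.
Import numFieldNormedType.Exports.

Local Open Scope classical_set_scope.
Local Open Scope ring_scope.

(* R^n is 'rV[R]_n, with its Borel sigma-algebra.  The norm carried by 'rV[R]_n
   in the library is the sup norm; it induces the usual topology, but the
   Euclidean norm has to be written out, see enorm below.  Products carry the
   product sigma-algebra of the library, which is again the Borel one. *)
HB.instance Definition _ (R : realType) (m n : nat) :=
  @isMeasurable.Build (sigma_display (@open 'M[R]_(m, n))) 'M[R]_(m, n)
    <<s @open 'M[R]_(m, n) >> (@sigma_algebra0 _ setT _) (@sigma_algebraC _ _)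
    (@sigma_algebra_bigcup _ setT _).

Section measurability.
Context {R : realType}.

Lemma measurable_coord (m n : nat) (i : 'I_m) (j : 'I_n) :
  measurable_fun setT (fun M : 'M[R]_(m, n) => M i j).
Proof.
apply: (measurability (@RGenOInfty.G R) (RGenOInfty.measurableE R)).
move=> _ [_ [x ->] <-]; rewrite setTI; apply: sub_sigma_algebra.
apply: open_comp => [M _|]; first exact: coord_continuous.
exact: interval_open.
Qed.

Lemma measurable_fun_mx d (T : measurableType d) (m n : nat)
    (f : T -> 'M[R]_(m, n)) :
  (forall i j, measurable_fun setT (fun x => f x i j)) -> measurable_fun setT f.
Proof.
move=> mf; apply: (measurability (@open 'M[R]_(m, n))) => //.
move=> _ [U oU <-]; rewrite setTI.
pose box (q : 'M[rat]_(m, n)) (k : nat) : set 'M[R]_(m, n) :=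
  [set M | forall i j, ball (ratr (q i j) : R) k.+1%:R^-1 (M i j)].
pose J := ('M[rat]_(m, n) * nat)%type.
have -> : f @^-1` U = \bigcup_(p : J)
    (if `[< box p.1 p.2 `<=` U >] then f @^-1` (box p.1 p.2) else set0).
  apply/seteqP; split=> [x Ufx|x [p _]]; last by case: asboolP => // sU /sU.
  have /nbhs_ballP[e /= e0 eU] : nbhs (f x) U by exact: open_nbhs_nbhs.
  have [k ke] : exists k, k.+1%:R^-1 < e / 2 :> R.
    have e20 : 0 < e / 2 by rewrite divr_gt0.
    have [k _ /(_ k (leqnn k)) ke] := near_infty_natSinv_lt (PosNum e20).
    by exists k.
  have k0 : 0 < k.+1%:R^-1 :> R by rewrite invr_gt0.
  have qP i j : exists q : rat, ball (ratr q : R) k.+1%:R^-1 (f x i j).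
    have [|q] := @rat_in_itvoo R (f x i j) (f x i j + k.+1%:R^-1).
      by rewrite ltrDl.
    rewrite in_itv /= => /andP[q1 q2]; exists q.
    by rewrite /ball /= ger0_norm ?subr_ge0 1?ltW// ltrBlDl.
  pose q : 'M[rat]_(m, n) := \matrix_(i, j) projT1 (cid (qP i j)).
  have bq : box q k (f x) by move=> i j; rewrite mxE; case: cid.
  exists (q, k) => //=; case: asboolP => // sU; exfalso; apply: sU => M bM.
  apply: eU; split=> // i j.
  have := bM i j; have := bq i j; rewrite /ball /= => h1 h2.
  apply: le_lt_trans (ler_distD (ratr (q i j)) _ _) _.
  by rewrite [ltRHS]splitr distrC ltrD// (lt_trans _ ke).
apply: countable_bigcupT_measurable => [|[q k]].
  exact: countableP.
case: asboolP => //= _.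
have -> : f @^-1` box q k = \bigcap_(p : 'I_m * 'I_n)
    ((fun x => f x p.1 p.2) @^-1` ball (ratr (q p.1 p.2) : R) k.+1%:R^-1).
  by apply/seteqP; split=> [x h [i j] _|x h i j]; [exact: h|exact: (h (i, j))].
apply: fin_bigcap_measurable => // -[i j] _.
rewrite -[X in measurable X]setTI; apply: mf => //.
exact: measurable_ball.
Qed.

End measurability.

Definition push (R : realType) d1 d2 (T1 : measurableType d1)
    (T2 : measurableType d2) (mu : probability T1 R) (f : {mfun T1 >-> T2}) :
  probability T2 R := distribution mu f.

Section wasserstein_geometry.
Context {R : realType} {n : nat}.
Local Notation E := 'rV[R]_n.
Implicit Types (x y : E) (p : E * E).
Implicit Types (mu nu : probability E R) (pi v w : probability (E * E)%type R).

Definition enorm x : R := Num.sqrt (\sum_(i < n) x ord0 i ^+ 2).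

Definition dilation (c : R) x : E := c *: x.
Definition move_along (t : R) (p : E * E) : E := p.1 + t *: p.2.
Definition scale_velocity (c : R) (p : E * E) : E * E := (p.1, c *: p.2).
Definition displacement (p : E * E) : E * E := (p.1, p.2 - p.1).
Definition pr1 (p : E * E) : E := p.1.
Definition pr2 (p : E * E) : E := p.2.
Definition pr12 (z : E * E * E) : E * E := z.1.
Definition pr13 (z : E * E * E) : E * E := (z.1.1, z.2).

Lemma measurable_dilation c : measurable_fun setT (dilation c).
Proof.
apply: measurable_fun_mx => i j; under eq_fun do rewrite mxE.
apply: measurable_funM; first exact: measurable_cst.
exact: measurable_coord.
Qed.

Lemma measurable_pr1 : measurable_fun setT pr1.
Proof. exact: measurable_fst. Qed.

Lemma measurable_pr2 : measurable_fun setT pr2.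
Proof. exact: measurable_snd. Qed.

Lemma measurable_move_along t : measurable_fun setT (move_along t).
Proof.
apply: measurable_fun_mx => i j; under eq_fun do rewrite !mxE.
apply: measurable_funD.
  exact: (measurableT_comp (measurable_coord i j) measurable_fst).
apply: measurable_funM; first exact: measurable_cst.
exact: (measurableT_comp (measurable_coord i j) measurable_snd).
Qed.

Lemma measurable_scale_velocity c : measurable_fun setT (scale_velocity c).
Proof.
apply: measurable_fun_pair; first exact: measurable_fst.
exact: (measurableT_comp (measurable_dilation c) measurable_snd).
Qed.

Lemma measurable_displacement : measurable_fun setT displacement.
Proof.
apply: measurable_fun_pair; first exact: measurable_fst.
apply: measurable_fun_mx => i j; under eq_fun do rewrite !mxE.
apply: measurable_funB.
  exact: (measurableT_comp (measurable_coord i j) measurable_snd).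
exact: (measurableT_comp (measurable_coord i j) measurable_fst).
Qed.

Lemma measurable_pr12 : measurable_fun setT pr12.
Proof. exact: measurable_fst. Qed.

Lemma measurable_pr13 : measurable_fun setT pr13.
Proof.
apply: measurable_fun_pair; last exact: measurable_snd.
exact: (measurableT_comp measurable_fst measurable_fst).
Qed.

HB.instance Definition _ c :=
  isMeasurableFun.Build _ _ _ _ (dilation c) (measurable_dilation c).
HB.instance Definition _ t :=
  isMeasurableFun.Build _ _ _ _ (move_along t) (measurable_move_along t).
HB.instance Definition _ c :=
  isMeasurableFun.Build _ _ _ _ (scale_velocity c) (measurable_scale_velocity c).
HB.instance Definition _ :=
  isMeasurableFun.Build _ _ _ _ displacement measurable_displacement.
HB.instance Definition _ :=
  isMeasurableFun.Build _ _ _ _ pr1 measurable_pr1.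
HB.instance Definition _ :=
  isMeasurableFun.Build _ _ _ _ pr2 measurable_pr2.
HB.instance Definition _ :=
  isMeasurableFun.Build _ _ _ _ pr12 measurable_pr12.
HB.instance Definition _ :=
  isMeasurableFun.Build _ _ _ _ pr13 measurable_pr13.

Local Open Scope ereal_scope.

(* Measures of the library are functions on all sets, constrained on measurable
   sets only: they are compared with measure_eq (notation ≡μ), and the sets of
   measures below are closed under it. *)
Definition P2 : set (probability E R) :=
  [set mu | \int[mu]_x (enorm x ^+ 2)%:E < +oo].

Definition P2_pairs : set (probability (E * E)%type R) :=
  [set v | \int[v]_p (enorm p.1 ^+ 2 + enorm p.2 ^+ 2)%:E < +oo].

Definition P2_triples : set (probability (E * E * E)%type R) :=
  [set a | \int[a]_z
     (enorm z.1.1 ^+ 2 + enorm z.1.2 ^+ 2 + enorm z.2 ^+ 2)%:E < +oo].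

Definition plans mu nu : set (probability (E * E)%type R) :=
  [set pi | [/\ P2_pairs pi, push pi pr1 ≡μ mu & push pi pr2 ≡μ nu]].

Definition cost pi : \bar R := \int[pi]_p (enorm (p.1 - p.2) ^+ 2)%:E.

Definition W2 mu nu : \bar R :=
  ereal_inf [set cost pi | pi in plans mu nu] `^ 2^-1.

Definition opt_plans mu nu : set (probability (E * E)%type R) :=
  [set pi | plans mu nu pi /\
     forall pi', plans mu nu pi' -> cost pi <= cost pi'].

Definition velocity_plans mu : set (probability (E * E)%type R) :=
  [set v | P2_pairs v /\ push v pr1 ≡μ mu].

(* The distance W_mu: the base measure mu enters only through the requirement
   that v and w belong to velocity_plans mu. *)
Definition Wvel v w : \bar R :=
  ereal_inf [set \int[a]_z (enorm (z.1.2 - z.2) ^+ 2)%:E |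
    a in [set a | [/\ P2_triples a, push a pr12 ≡μ v & push a pr13 ≡μ w]]]
  `^ 2^-1.

Definition scale_plan (c : R) v : probability (E * E)%type R :=
  push v (scale_velocity c).

Definition zero_plan mu : probability (E * E)%type R :=
  mu \x \d_(0 : E)%R.

Definition curve_of v (t : R) : probability E R := push v (move_along t).

Definition geodesic_on (c : R -> probability E R) (e : R) : Prop :=
  exists2 C : R, (0 <= C)%R &
    forall t1 t2 : R, (0 <= t1 <= e)%R -> (0 <= t2 <= e)%R ->
      W2 (c t1) (c t2) = (C * `|t2 - t1|)%:E.

Definition geodesic_directions mu : set (probability (E * E)%type R) :=
  [set v | velocity_plans mu v /\
     exists2 e : R, (0 < e)%R & geodesic_on (curve_of v) e].

Definition tangent_space mu : set (probability (E * E)%type R) :=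
  [set v | velocity_plans mu v /\
     forall e : R, (0 < e)%R ->
       exists2 w, geodesic_directions mu w & Wvel v w < e%:E].

(* liminf over w -> v, t -> 0+ (the value w = v is allowed), as the supremum
   over e > 0 of the infimum over the e-neighbourhood. *)
Definition Hminus (F : probability E R -> \bar R) mu v : \bar R :=
  ereal_sup [set ereal_inf [set q | exists w t,
      [/\ velocity_plans mu w, Wvel w v < e%:E, (0 < t < e)%R,
          geodesic_on (curve_of w) t &
          q = (F (curve_of w t) - F mu) * t^-1%:E]]
    | e in [set e : R | (0 < e)%R]].

Definition neg_part (s : \bar R) : R := fine (maxe (- s) 0).

Definition unit_tangents mu : set (probability (E * E)%type R) :=
  [set w | tangent_space mu w /\ Wvel w (zero_plan mu) = 1].

Definition steepest_directions (F : probability E R -> \bar R) mu :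
    set (probability (E * E)%type R) :=
  [set u | [/\ F mu < +oo,
     forall v, tangent_space mu v -> -oo < Hminus F mu v &
     exists v, [/\ unit_tangents mu v,
       forall w, unit_tangents mu w -> Hminus F mu v <= Hminus F mu w &
       u ≡μ scale_plan (neg_part (Hminus F mu v)) v]]].

Definition inv_exp mu nu : set (probability (E * E)%type R) :=
  [set v | exists2 pi, opt_plans mu nu pi & v ≡μ push pi displacement].

Definition tangent_vector (c : R -> probability E R) (t : R) v : Prop :=
  tangent_space (c t) v /\
  forall vh : R -> probability (E * E)%type R,
    (forall h : R, (0 < h)%R -> inv_exp (c t) (c (t + h)%R) (vh h)) ->
    Wvel v (scale_plan h^-1 (vh h)) @[h --> 0^'+] --> 0.

Definition locally_absolutely_continuous (c : R -> probability E R) : Prop :=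
  forall a b : R, (0 <= a)%R -> (a <= b)%R ->
  exists2 m : R -> R, lebesgue_measure.-integrable `[a, b] (EFin \o m) &
    forall s t : R, (a <= s)%R -> (s <= t)%R -> (t <= b)%R ->
      W2 (c s) (c t) <= \int[lebesgue_measure]_(x in `[s, t]) (m x)%:E.

(* A curve on [0, oo[ is a function on R, of which only the values at t >= 0
   matter. *)
Definition steepest_descent_flow (F : probability E R -> \bar R)
    (c : R -> probability E R) : Prop :=
  [/\ forall t : R, (0 <= t)%R -> P2 (c t),
      locally_absolutely_continuous c &
      forall t : R, (0 <= t)%R ->
        exists2 v, tangent_vector c t v & steepest_directions F (c t) v].

Definition interaction_energy (K : E -> E -> R) mu : \bar R :=
  (2^-1)%:E * \int[mu \x mu]_z (K z.1 z.2)%:E.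

Definition riesz_kernel (r : R) x y : R := (- (enorm (x - y) `^ r))%R.

Definition unit_second_moment : set (probability E R) :=
  [set eta | P2 eta /\ \int[eta]_x (enorm x ^+ 2)%:E = 1].

Definition unique_minimizer (F : probability E R -> \bar R)
    (A : set (probability E R)) mu : Prop :=
  [/\ A mu, forall nu, A nu -> F mu <= F nu &
      forall nu, A nu -> (forall nu', A nu' -> F nu <= F nu') -> nu ≡μ mu].

End wasserstein_geometry.

(* Main.v *)
Require Import Defs.
From HB Require Import structures.
From mathcomp Require Import all_boot all_order all_algebra.
From mathcomp Require Import all_classical all_reals all_analysis.
From mathcomp Require Import measurable_realfun giry.
From mathcomp Require Import ring lra.

Set Implicit Arguments.
Unset Strict Implicit.
Unset Printing Implicit Defensive.

Import Order.TTheory GRing.Theory Num.Theory.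
Import numFieldNormedType.Exports.

Local Open Scope classical_set_scope.
Local Open Scope ring_scope.

(** Write gamma_a for the image of eta under the dilation of factor a, so that
    the curve is gamma_(alpha t).  The energy is r-homogeneous under dilations,
    and rescaling the minimality of eta to an arbitrary measure nu, whose second
    moment is m^2, gives the sharp inequality EK(nu) >= m^r EK(eta)
    ([energy_lower_bound]).  This single inequality replaces every computation
    of the differential of EK.  If w is a velocity plan over gamma_a whose
    velocities have L2 norm m, Cauchy-Schwarz bounds the second moment of the
    moved measure by (a + t m)^2.  Since EK(eta) <= 0, EK decreases along w at
    most as fast as along the radial motion of speed m, for which homogeneity
    gives its exact value.  The tangent-line inequality for the power r yields

      H_v EK(gamma_a) >= r a^(r-1) |v| EK(eta)   for every plan v of speed |v|

    ([Hminus_ge]) with equality for the radial plan v, the law of (a X, X) when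
    X has law eta ([Hminus_ray]).  Hence the radial plan is a steepest unit
    tangent and the steepest direction is the law of (a X, b X) with
    b = - r a^(r-1) EK(eta) ([steepest_directions_ray]).  The description of the
    radial plan as a law of (a X, X) makes sense at a = 0 too, where it is the
    product of the Dirac mass with eta, so that the initial time t = 0 is covered
    by the same argument, with 0^0 = 1 if r = 1.

    On the side of the curve, the distance between gamma_a and gamma_b is
    |a - b| by Cauchy-Schwarz ([W2_dilation]), and for 0 <= a <= b the only optimal
    plan is the law of (a X, b X), because equality in Cauchy-Schwarz forces
    collinearity ([opt_plan_ray]).  The tangent vector at t is therefore the
    law of (alpha_t X, alpha'_t X) with the right derivative alpha'_t
    ([dilation_curve_tangent]).  Finally alpha, a multiple of a power of t,
    solves alpha' = - r alpha^(r-1) EK(eta), also at t = 0, and this is the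
    factor b above. *)

(** * Real powers on the half-line *)

Section real_powers.
Context {R : realType}.
Implicit Types p q x y : R.

(** Young's inequality applied to y and x^(p-1) with the conjugate exponents p and
    p / (p - 1).  Argued this way rather than from the derivative, the inequality
    includes the endpoint x = 0, and p = 1 with the convention 0^0 = 1. *)
Lemma powR_above_tangent p x y : 1 <= p -> 0 <= x -> 0 <= y ->
  x `^ p + p * x `^ (p - 1) * (y - x) <= y `^ p.
Proof.
move=> p1 x0 y0.
have xE : x * x `^ (p - 1) = x `^ p by rewrite mulr_powRB1// (lt_le_trans ltr01).
have [->|pn1] := eqVneq p 1.
  by rewrite subrr powRr0 !powRr1// !mul1r subrKC.
have p0 : 0 < p by rewrite (lt_le_trans ltr01).
have q0 : 0 < p - 1 by rewrite subr_gt0 lt_neqAle eq_sym pn1.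
have := @conjugate_powR R y (x `^ (p - 1)) p (p / (p - 1)) y0 (powR_ge0 _ _) p0.
rewrite divr_gt0// => /(_ isT).
have qE : (p - 1) * (p / (p - 1)) = p by field; rewrite gt_eqF.
rewrite -powRrM qE invf_div => H.
have {}H : y * x `^ (p - 1) <= y `^ p / p + x `^ p * ((p - 1) / p).
  by apply: H; field; rewrite gt_eqF.
have : p * (y * x `^ (p - 1)) <= y `^ p + x `^ p * (p - 1).
  have -> : y `^ p + x `^ p * (p - 1) = p * (y `^ p / p + x `^ p * ((p - 1) / p)).
    by field; rewrite gt_eqF.
  by rewrite ler_pM2l.
rewrite -xE; lra.
Qed.

(** Only the right-hand limit: at x = 0 the power is 1 on the negative half-line. *)
Lemma powR_cvg_right q x : 0 <= q -> 0 <= x ->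
  (x + s) `^ q @[s --> 0^'+] --> x `^ q.
Proof.
rewrite le_eqVlt => /predU1P[<- _|q0].
  by rewrite powRr0; under eq_fun do rewrite powRr0; exact: cvg_cst.
rewrite le_eqVlt => /predU1P[<-|x0].
  by rewrite powR0 ?gt_eqF//; under eq_fun do rewrite add0r; exact: powR_cvg0.
have cx : {for x, continuous (@powR R ^~ q)}.
  apply: differentiable_continuous; apply/derivable1_diffP.
  by apply: derivable_powR; rewrite in_itv/= x0.
have xs : x + s @[s --> 0^'+] --> x + 0.
  by apply: cvgD; [exact: cvg_cst|exact: cvg_at_right_filter].
by rewrite addr0 in xs; apply: cvg_comp xs cx.
Qed.

End real_powers.

(** * The Euclidean norm *)

Section euclidean.
Context {R : realType} {n : nat}.
Local Notation E := 'rV[R]_n.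
Implicit Types x y : E.

Definition dot x y : R := \sum_(i < n) x ord0 i * y ord0 i.

Lemma enorm_ge0 x : 0 <= enorm x.
Proof. exact: sqrtr_ge0. Qed.

Lemma enorm_sqr x : enorm x ^+ 2 = dot x x.
Proof.
by rewrite sqr_sqrtr ?sumr_ge0// => *; rewrite sqr_ge0.
Qed.

Lemma enormZ c x : enorm (c *: x) = `|c| * enorm x.
Proof.
rewrite /enorm; under eq_bigr do rewrite mxE exprMn.
by rewrite -mulr_sumr sqrtrM ?sqr_ge0// sqrtr_sqr.
Qed.

Lemma enorm_sqr_lin a b x y : enorm (a *: x + b *: y) ^+ 2 =
  a ^+ 2 * enorm x ^+ 2 + 2 * a * b * dot x y + b ^+ 2 * enorm y ^+ 2.
Proof.
rewrite !enorm_sqr /dot !mulr_sumr -!big_split/=; apply: eq_bigr => i _.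
rewrite !mxE; ring.
Qed.

Lemma enorm_sqr_eq0 x : enorm x ^+ 2 = 0 -> x = 0.
Proof.
rewrite enorm_sqr => /eqP; rewrite psumr_eq0 => [/allP h|i _]; last exact: sqr_ge0.
apply/rowP => i; rewrite mxE; apply/eqP.
by have := h i (mem_index_enum _); rewrite mulf_eq0 orbb.
Qed.

Lemma measurable_enorm : measurable_fun setT (@enorm R n).
Proof.
apply: (measurableT_comp (f := @Num.sqrt R)).
  by apply: continuous_measurable_fun; exact: sqrt_continuous.
apply: measurable_sum => i; apply: measurable_funX; exact: measurable_coord.
Qed.

Lemma measurable_lin d (T : measurableType d) (f g : T -> E) (a b : R) :
  measurable_fun setT f -> measurable_fun setT g ->
  measurable_fun setT (fun z => a *: f z + b *: g z).
Proof.
move=> mf mg; apply: measurable_fun_mx => i j; under eq_fun do rewrite !mxE.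
by apply: measurable_funD; apply: measurable_funM => //;
  apply: measurableT_comp (measurable_coord _ _) _.
Qed.

Lemma measurable_sqnorm d (T : measurableType d) (f : T -> E) :
  measurable_fun setT f -> measurable_fun setT (fun z => enorm (f z) ^+ 2).
Proof.
by move=> mf; apply: measurable_funX; exact: measurableT_comp measurable_enorm mf.
Qed.

Lemma measurable_dot d (T : measurableType d) (f g : T -> E) :
  measurable_fun setT f -> measurable_fun setT g ->
  measurable_fun setT (fun z => dot (f z) (g z)).
Proof.
move=> mf mg; apply: measurable_sum => i.
by apply: measurable_funM; apply: measurableT_comp (measurable_coord _ _) _.
Qed.

Lemma measurable_subr d (T : measurableType d) (f g : T -> E) :
  measurable_fun setT f -> measurable_fun setT g ->
  measurable_fun setT (fun z => f z - g z).
Proof.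
move=> mf mg; under eq_fun do rewrite -[f _]scale1r -scaleN1r.
exact: measurable_lin.
Qed.

End euclidean.

(** * Quadratic expansion of second moments *)

Section L2.
Context {R : realType} {n : nat} d (T : measurableType d) (P : probability T R).
Local Notation E := 'rV[R]_n.
Implicit Types f g : T -> E.

Lemma L2_norm f : (\int[P]_z (enorm (f z) ^+ 2)%:E < +oo)%E ->
  exists2 A : R, 0 <= A & (\int[P]_z (enorm (f z) ^+ 2)%:E = (A ^+ 2)%:E)%E.
Proof.
move=> fi; have f0 : (0 <= \int[P]_z (enorm (f z) ^+ 2)%:E)%E.
  by apply: integral_ge0 => z _; rewrite lee_fin sqr_ge0.
exists (Num.sqrt (fine (\int[P]_z (enorm (f z) ^+ 2)%:E)%E)) => //.
by rewrite sqr_sqrtr ?fine_ge0// fineK// ge0_fin_numE.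
Qed.

Lemma L2_integrable f (A : R) : measurable_fun setT f ->
  (\int[P]_z (enorm (f z) ^+ 2)%:E = A%:E)%E ->
  P.-integrable setT (fun z => (enorm (f z) ^+ 2)%:E).
Proof.
move=> mf fA; apply/integrableP; split.
  by apply/measurable_EFinP; exact: measurable_sqnorm.
under eq_integral do rewrite gee0_abs ?lee_fin ?sqr_ge0//.
by rewrite fA ltry.
Qed.

(** C is the integral of the inner product, and its bound, the Cauchy-Schwarz
    inequality, follows from the nonnegativity of the quadratic form in s and t.
    Minkowski's inequality and the equality case of Cauchy-Schwarz are obtained
    below by choosing s and t. *)
Lemma L2_expansion f g (A B : R) : measurable_fun setT f -> measurable_fun setT g ->
  0 <= A -> 0 <= B ->
  (\int[P]_z (enorm (f z) ^+ 2)%:E = (A ^+ 2)%:E)%E ->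
  (\int[P]_z (enorm (g z) ^+ 2)%:E = (B ^+ 2)%:E)%E ->
  exists2 C : R, `|C| <= A * B & forall s t : R,
    (\int[P]_z (enorm (s *: f z + t *: g z) ^+ 2)%:E =
      (s ^+ 2 * A ^+ 2 + 2 * s * t * C + t ^+ 2 * B ^+ 2)%:E)%E.
Proof.
move=> mf mg A0 B0 fA gB.
have fi := L2_integrable mf fA; have gi := L2_integrable mg gB.
have di : P.-integrable setT (fun z => (dot (f z) (g z))%:E).
  apply: (le_integrable measurableT _ _ (integrableD measurableT fi gi)) => /=.
    by apply/measurable_EFinP; exact: measurable_dot.
  move=> z _; rewrite lee_fin [leRHS]ger0_norm ?addr_ge0 ?sqr_ge0//.
  have := sqr_ge0 (enorm (1 *: f z + 1 *: g z)).
  have := sqr_ge0 (enorm (1 *: f z + (-1) *: g z)).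
  have := sqr_ge0 (enorm (f z)); have := sqr_ge0 (enorm (g z)).
  rewrite !enorm_sqr_lin ler_norml; lra.
have ex s t : (\int[P]_z (enorm (s *: f z + t *: g z) ^+ 2)%:E =
  (s ^+ 2 * A ^+ 2 + 2 * s * t * fine (\int[P]_z (dot (f z) (g z))%:E)%E
   + t ^+ 2 * B ^+ 2)%:E)%E.
  rewrite (eq_integral (fun z => (s ^+ 2)%:E * (enorm (f z) ^+ 2)%:E +
    (2 * s * t)%:E * (dot (f z) (g z))%:E +
    (t ^+ 2)%:E * (enorm (g z) ^+ 2)%:E)%E); last first.
    by move=> z _; rewrite enorm_sqr_lin.
  have [sf stfg tg] : [/\
      P.-integrable setT (fun z => ((s ^+ 2)%:E * (enorm (f z) ^+ 2)%:E)%E),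
      P.-integrable setT (fun z => ((2 * s * t)%:E * (dot (f z) (g z))%:E)%E) &
      P.-integrable setT (fun z => ((t ^+ 2)%:E * (enorm (g z) ^+ 2)%:E)%E)].
    by split; exact: integrableZl.
  rewrite integralD//=; last exact: integrableD.
  rewrite integralD//= !integralZl// fA gB !EFinD !EFinM fineK//.
  exact: integrable_fin_num.
set C := fine _ in ex; exists C => //.
have H s t : 0 <= s ^+ 2 * A ^+ 2 + 2 * s * t * C + t ^+ 2 * B ^+ 2.
  by rewrite -lee_fin -ex integral_ge0// => z _; rewrite lee_fin sqr_ge0.
rewrite -ler_sqr ?nnegrE ?mulr_ge0// real_normK ?num_real//.
move: A0; rewrite le_eqVlt => /predU1P[A0|A0].
  rewrite -A0 mul0r expr0n /=; have [->|C0] := eqVneq C 0; first by rewrite expr0n.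
  (* If A = 0 the form at t = 1 is affine in s with slope 2 C, and this s would
     make it equal to -1. *)
  have := H (- (B ^+ 2 + 1) / (2 * C)) 1.
  have -> : 2 * (- (B ^+ 2 + 1) / (2 * C)) * 1 * C = - (B ^+ 2 + 1) by field.
  rewrite -A0; lra.
have := H (- C) (A ^+ 2).
have -> : (- C) ^+ 2 * A ^+ 2 + 2 * - C * A ^+ 2 * C + (A ^+ 2) ^+ 2 * B ^+ 2 =
  A ^+ 2 * ((A * B) ^+ 2 - C ^+ 2) by ring.
by rewrite pmulr_rge0 ?exprn_gt0// subr_ge0.
Qed.

End L2.

(** * Integrals against image measures *)

Section transport_of_integrals.
Context {R : realType} d1 d2 (T1 : measurableType d1) (T2 : measurableType d2).

Lemma integral_push (P : probability T1 R) (f : {mfun T1 >-> T2})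
    (h : T2 -> \bar R) : measurable_fun setT h -> (forall y, 0 <= h y)%E ->
  (\int[push P f]_y h y = \int[P]_x h (f x))%E.
Proof. by move=> mh h0; exact: ge0_integral_distribution. Qed.

Lemma integral_measure_eq (P Q : probability T1 R) (h : T1 -> \bar R) :
  P ≡μ Q -> (\int[P]_x h x = \int[Q]_x h x)%E.
Proof. by move=> PQ; apply: eq_measure_integral => A mA _; exact: PQ. Qed.

Lemma push_measure_eq (P Q : probability T1 R) (f : {mfun T1 >-> T2}) :
  P ≡μ Q -> push P f ≡μ push Q f.
Proof. by move=> PQ A mA; apply: PQ; exact: measurable_funPTI. Qed.

(** In terms of preimages rather than of image measures, so that f may be the
    identity and the left-hand side the measure P itself. *)
Lemma ae_eq_preimage (P : probability T1 R) (f g : T1 -> T2) (A : set T2) :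
  measurable_fun setT f -> measurable_fun setT g -> measurable A ->
  {ae P, forall x, f x = g x} -> P (f @^-1` A) = P (g @^-1` A).
Proof.
move=> mf mg mA fg.
have mE (h : T1 -> T2) : measurable_fun setT h -> measurable (h @^-1` A).
  by move=> mh; rewrite -[X in measurable X]setTI; exact: mh.
have mI (h : T1 -> T2) : measurable_fun setT h ->
    measurable_fun setT (fun x => (\1_(h @^-1` A) x)%:E : \bar R).
  by move=> mh; apply/measurable_EFinP; apply: measurable_indic; exact: mE.
have muE (h : T1 -> T2) : measurable_fun setT h ->
    P (h @^-1` A) = (\int[P]_x (\1_(h @^-1` A) x)%:E)%E.
  by move=> mh; rewrite integral_indic ?setIT//; exact: mE.
rewrite !muE//.
apply: ge0_ae_eq_integral => //;
  [exact: mI|exact: mI|by move=> x _; rewrite lee_fin..|].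
  apply: filterS fg => x fgx _.
  rewrite !indicE; congr ((nat_of_bool _)%:R%:E).
  by apply/idP/idP => /set_mem /= fgA; apply/mem_set => /=; move: fgA; rewrite fgx.
Qed.

End transport_of_integrals.

Section L2_zero.
Context {R : realType} {n : nat} d (T : measurableType d) (P : probability T R).

Lemma L2_zero_ae (f : T -> 'rV[R]_n) : measurable_fun setT f ->
  (\int[P]_z (enorm (f z) ^+ 2)%:E = 0)%E -> {ae P, forall z, f z = 0}.
Proof.
move=> mf f0.
have mF : measurable_fun setT (fun z => (enorm (f z) ^+ 2)%:E).
  by apply/measurable_EFinP; exact: measurable_sqnorm.
have [F0 _] := ae_eq_integral_abs P measurableT mF.
have {}F0 : ae_eq P setT (fun z => (enorm (f z) ^+ 2)%:E) (cst 0%E).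
  apply: F0; rewrite -[RHS]f0; apply: eq_integral => z _.
  by rewrite gee0_abs// lee_fin sqr_ge0.
by apply: filterS F0 => z /(_ I)[]; exact: enorm_sqr_eq0.
Qed.

End L2_zero.

(** * Homogeneity of the interaction energy *)

Section energy.
Context {R : realType} {n : nat} (r : R) (r0 : 0 <= r) (r2 : r <= 2).
Local Notation E := 'rV[R]_n.
Implicit Types mu nu : probability E R.

Let dist_r (z : E * E) : \bar R := (enorm (z.1 - z.2) `^ r)%:E.

Let dist_r_ge0 z : (0 <= dist_r z)%E.
Proof. by rewrite lee_fin powR_ge0. Qed.

Let measurable_dist_r : measurable_fun setT dist_r.
Proof.
apply/measurable_EFinP; apply: (measurableT_comp (measurable_powR _)).
apply: (measurableT_comp measurable_enorm).
exact: measurable_subr measurable_fst measurable_snd.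
Qed.

Let measurable_dist_r2 x : measurable_fun setT (fun y => dist_r (x, y)).
Proof. by apply: measurableT_comp measurable_dist_r _; exact: measurable_pair1. Qed.

(** The interaction energy is - spread / 2.  The nonnegative kernel, written as an
    iterated integral, can be handled by Tonelli's theorem with no integrability
    assumption, and depends on the measure only through measurable sets. *)
Definition spread mu : \bar R :=
  (\int[mu]_x \int[mu]_y (enorm (x - y) `^ r)%:E)%E.

Let measurable_inner mu :
  measurable_fun setT (fun x => \int[mu]_y dist_r (x, y))%E.
Proof. exact: (@measurable_fun_fubini_tonelli_F _ _ _ _ _ mu dist_r). Qed.

Let inner_ge0 mu x : (0 <= \int[mu]_y dist_r (x, y))%E.
Proof. exact: integral_ge0. Qed.

Lemma spread_ge0 mu : (0 <= spread mu)%E.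
Proof. by apply: integral_ge0 => x _; exact: inner_ge0. Qed.

Lemma energyE mu :
  interaction_energy (riesz_kernel r) mu = (- ((2^-1)%:E * spread mu))%E.
Proof.
rewrite /interaction_energy -muleN; congr (_ * _)%E.
transitivity (\int[mu \x mu]_z (- dist_r z))%E; first exact: eq_integral.
rewrite integral_ge0N//; congr (- _)%E.
exact: (fubini_tonelli1 dist_r).
Qed.

Lemma spread_measure_eq mu nu : mu ≡μ nu -> spread mu = spread nu.
Proof.
move=> mn; rewrite /spread (integral_measure_eq _ mn).
by apply: eq_integral => x _; exact: integral_measure_eq.
Qed.

Lemma spread_dilation c mu : 0 <= c ->
  spread (push mu (dilation c)) = ((c `^ r)%:E * spread mu)%E.
Proof.
move=> c0; have cr0 : (0 <= (c `^ r)%:E :> \bar R)%E by rewrite lee_fin powR_ge0.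
rewrite /spread.
rewrite -(ge0_integralZl _ measurableT (measurable_inner mu) (fun x _ => inner_ge0 mu x) cr0).
rewrite (integral_push mu (dilation c) (measurable_inner (push mu (dilation c)))
  (inner_ge0 (push mu (dilation c)))).
apply: eq_integral => x _.
rewrite (integral_push mu (dilation c) (measurable_dist_r2 _) (fun y => dist_r_ge0 _)).
rewrite -(ge0_integralZl _ measurableT (measurable_dist_r2 x) (fun y _ => dist_r_ge0 _) cr0).
apply: eq_integral => y _ /=.
by rewrite /dist_r/= /dilation -scalerBr enormZ ger0_norm// powRM ?enorm_ge0// EFinM.
Qed.

(** As r <= 2, the r-th power of the distance is at most
    1 + |x - y|^2 <= 1 + 2 |x|^2 + 2 |y|^2. *)
Lemma spread_lty mu : P2 mu -> (spread mu < +oo)%E.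
Proof.
move=> mu2; have [A A0 mA] := L2_norm (f := idfun) mu2.
have mi := L2_integrable (f := idfun) (@measurable_id _ _ _) mA.
have mN : measurable_fun setT (fun y : E => (enorm y ^+ 2)%:E).
  by apply/measurable_EFinP; exact: (measurable_sqnorm (@measurable_id _ _ setT)).
have bound x y : (dist_r (x, y) <= (1 + 2 * enorm x ^+ 2)%:E + 2%:E * (enorm y ^+ 2)%:E)%E.
  rewrite -EFinM -EFinD lee_fin /dist_r/=.
  apply: (@le_trans _ _ (1 + enorm (x - y) ^+ 2)).
    have [s1|s1] := leP (enorm (x - y)) 1.
      rewrite (@le_trans _ _ 1) ?lerDl ?sqr_ge0//.
      have -> : 1 = 1 `^ r :> R by rewrite powR1.
      by rewrite ge0_ler_powR ?nnegrE ?enorm_ge0.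
    rewrite -powR_mulrn ?enorm_ge0// (@le_trans _ _ (enorm (x - y) `^ 2%:R))//.
      by rewrite ler_powR// ltW.
    by rewrite lerDr.
  have := sqr_ge0 (enorm (1 *: x + 1 *: y)); rewrite enorm_sqr_lin.
  have := enorm_sqr_lin 1 (-1) x y; rewrite scaleN1r scale1r => ->; lra.
have affine_ge0 a y : 0 <= a -> (0 <= a%:E + 2%:E * (enorm y ^+ 2)%:E :> \bar R)%E.
  by move=> a0; rewrite -EFinM -EFinD lee_fin addr_ge0// mulr_ge0// sqr_ge0.
have maffine a : measurable_fun setT
    (fun y : E => (a%:E + 2%:E * (enorm y ^+ 2)%:E)%E).
  by apply: emeasurable_funD => //; exact: measurable_funeM.
have affineE a : 0 <= a ->
    (\int[mu]_y (a%:E + 2%:E * (enorm y ^+ 2)%:E) = (a + 2 * A ^+ 2)%:E)%E.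
  move=> a0; rewrite ge0_integralD//; last 2 first.
  - by move=> y _; rewrite -EFinM lee_fin mulr_ge0 ?sqr_ge0.
  - exact: measurable_funeM.
  rewrite integral_cst// [X in (_ * X + _)%E](_ : _ = 1%E) ?mule1; last exact: probability_setT.
  rewrite ge0_integralZl//; last first.
    by move=> y _; rewrite lee_fin sqr_ge0.
  by rewrite [X in (_ + _ * X)%E]mA -!EFinM -!EFinD.
have inner x : (\int[mu]_y dist_r (x, y) <=
    (1 + 2 * A ^+ 2)%:E + 2%:E * (enorm x ^+ 2)%:E)%E.
  have := sqr_ge0 (enorm x) => x0.
  apply: (@le_trans _ _ (\int[mu]_y
      ((1 + 2 * enorm x ^+ 2)%:E + 2%:E * (enorm y ^+ 2)%:E))%E).
    by apply: ge0_le_integral => // y _; apply: affine_ge0; lra.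
  rewrite affineE; last lra.
  by rewrite -EFinM -EFinD lee_fin; lra.
have A20 := sqr_ge0 A.
rewrite /spread; apply: (@le_lt_trans _ _ (\int[mu]_x
    ((1 + 2 * A ^+ 2)%:E + 2%:E * (enorm x ^+ 2)%:E))%E).
  exact: (ge0_le_integral _ measurableT (fun x _ => inner_ge0 mu x)
    (measurable_inner mu) (maffine _) (fun x _ => inner x)).
by rewrite affineE ?ltry//; lra.
Qed.

Local Notation EK := (interaction_energy (riesz_kernel r)).

Lemma energy_dilation c mu : 0 <= c ->
  EK (push mu (dilation c)) = ((c `^ r)%:E * EK mu)%E.
Proof. by move=> c0; rewrite !energyE spread_dilation// muleN muleCA. Qed.

Lemma energy_measure_eq mu nu : mu ≡μ nu -> EK mu = EK nu.
Proof. by move=> mn; rewrite !energyE (spread_measure_eq mn). Qed.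

Lemma energy_le0 mu : (EK mu <= 0)%E.
Proof. by rewrite energyE oppe_le0 mule_ge0// ?spread_ge0// lee_fin invr_ge0. Qed.

Lemma energy_fin_num mu : P2 mu -> EK mu \is a fin_num.
Proof.
move=> /spread_lty h.
by rewrite energyE fin_numN fin_numM// ge0_fin_numE// spread_ge0.
Qed.

End energy.

(** * Radial plans *)

Section rays.
Context {R : realType} {n : nat}.
Local Notation E := 'rV[R]_n.
Implicit Types (mu nu : probability E R) (w : probability (E * E)%type R).

(** The image of a measure under [ray a b] is the plan of radial motion: the mass
    at a x has velocity b x.  At a = 0 it is a general velocity law at the origin,
    which is not of the form velocity = factor times position. *)
Definition ray (a b : R) (x : E) : E * E := (a *: x, b *: x).

Lemma measurable_ray a b : measurable_fun setT (ray a b).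
Proof. by apply: measurable_fun_pair; exact: measurable_dilation. Qed.

HB.instance Definition _ a b :=
  isMeasurableFun.Build _ _ _ _ (ray a b) (measurable_ray a b).

Definition ray3 (a b c : R) (x : E) : E * E * E := (ray a b x, c *: x).

Lemma measurable_ray3 a b c : measurable_fun setT (ray3 a b c).
Proof.
by apply: measurable_fun_pair; [exact: measurable_ray|exact: measurable_dilation].
Qed.

HB.instance Definition _ a b c :=
  isMeasurableFun.Build _ _ _ _ (ray3 a b c) (measurable_ray3 a b c).

Lemma moment_lin d (T : measurableType d) (P : probability T R) (f : T -> E)
    (c : R) : measurable_fun setT f -> (\int[P]_x (enorm (c *: f x) ^+ 2)%:E =
  (c ^+ 2)%:E * \int[P]_x (enorm (f x) ^+ 2)%:E)%E.
Proof.
move=> mf; rewrite -ge0_integralZl// ?lee_fin ?sqr_ge0//.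
- by apply: eq_integral => x _; rewrite enormZ exprMn real_normK ?num_real.
- by apply/measurable_EFinP; exact: measurable_sqnorm.
- by move=> x _; rewrite lee_fin sqr_ge0.
Qed.

Lemma measurable_sqnorm_id : measurable_fun setT (fun x : E => (enorm x ^+ 2)%:E).
Proof. by apply/measurable_EFinP; exact: (measurable_sqnorm (@measurable_id _ _ setT)). Qed.

Lemma moment_push d (T : measurableType d) (P : probability T R) (f : {mfun T >-> E}) :
  (\int[push P f]_x (enorm x ^+ 2)%:E = \int[P]_x (enorm (f x) ^+ 2)%:E)%E.
Proof.
exact: (integral_push P f measurable_sqnorm_id (fun y => sqr_ge0 _)).
Qed.

Lemma moment_dilation mu c : (\int[push mu (dilation c)]_x (enorm x ^+ 2)%:E =
  (c ^+ 2)%:E * \int[mu]_x (enorm x ^+ 2)%:E)%E.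
Proof. by rewrite moment_push; exact: (moment_lin mu c (@measurable_id _ _ setT)). Qed.

Lemma moment_pr1 mu w : push w pr1 ≡μ mu ->
  (\int[w]_p (enorm p.1 ^+ 2)%:E = \int[mu]_x (enorm x ^+ 2)%:E)%E.
Proof. by move=> wm; rewrite -(integral_measure_eq _ wm) moment_push. Qed.

Lemma moment_pr2 mu w : push w pr2 ≡μ mu ->
  (\int[w]_p (enorm p.2 ^+ 2)%:E = \int[mu]_x (enorm x ^+ 2)%:E)%E.
Proof. by move=> wm; rewrite -(integral_measure_eq _ wm) moment_push. Qed.

End rays.

(** * Energy of an arbitrary measure *)

Section minimal_energy.
Context {R : realType} {n : nat} (r : R) (r0 : 0 < r).
Local Notation E := 'rV[R]_n.
Local Notation EK := (interaction_energy (riesz_kernel r : E -> E -> R)).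
Variable eta : probability E R.
Hypothesis eta_min : forall nu, unit_second_moment nu -> (EK eta <= EK nu)%E.

(** Dilating nu by 1 / m produces a competitor of eta.  If m = 0, nu is the Dirac
    mass at 0 and is its own image under the dilation of factor 0, so that its
    energy vanishes by homogeneity. *)
Lemma energy_lower_bound (nu : probability E R) (m : R) : EK eta \is a fin_num ->
  0 <= m -> (\int[nu]_x (enorm x ^+ 2)%:E = (m ^+ 2)%:E)%E ->
  ((m `^ r * fine (EK eta))%:E <= EK nu)%E.
Proof.
move=> etaf; rewrite le_eqVlt => /predU1P[<- nu0|m0 num].
  have nuE : nu ≡μ push nu (dilation 0).
    move=> A mA; apply: (ae_eq_preimage (f := idfun) (g := dilation 0)) => //.
      exact: measurable_id.
    rewrite expr0n in nu0; apply: filterS (L2_zero_ae (@measurable_id _ _ setT) nu0).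
    by move=> x /= ->; rewrite /dilation scaler0.
  rewrite (energy_measure_eq _ nuE) energy_dilation// ?(ltW r0)//.
  by rewrite powR0 ?gt_eqF// mul0r mul0e.
have : (EK eta <= EK (push nu (dilation m^-1)))%E.
  apply: eta_min.
  have mE : (\int[push nu (dilation m^-1)]_x (enorm x ^+ 2)%:E = 1)%E.
    rewrite moment_dilation num -EFinM -exprMn mulVf ?gt_eqF//.
    by rewrite expr1n.
  by split=> //; rewrite /P2/= mE ltry.
rewrite energy_dilation ?invr_ge0 ?(ltW m0) ?(ltW r0)//.
have mr : (0 <= (m `^ r)%:E :> \bar R)%E by rewrite lee_fin powR_ge0.
move=> /(lee_wpmul2l mr).
rewrite [leRHS]muleA -EFinM -powRM ?invr_ge0 ?(ltW m0)// mulfV ?gt_eqF// powR1 mul1e.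
by rewrite -[EK eta]fineK// -EFinM.
Qed.

End minimal_energy.

(** * Distance and optimal plans between dilations *)

Section wasserstein.
Context {R : realType} {n : nat}.
Local Notation E := 'rV[R]_n.
Variable eta : probability E R.
Hypothesis eta1 : (\int[eta]_x (enorm x ^+ 2)%:E = 1)%E.
Implicit Types (mu nu : probability E R) (pi v w : probability (E * E)%type R).

Lemma moment_scaled (c : R) : (\int[eta]_x (enorm (c *: x) ^+ 2)%:E = (c ^+ 2)%:E)%E.
Proof. by rewrite (moment_lin eta c (@measurable_id _ _ setT)) eta1 mule1. Qed.

Lemma moment_dilated mu a : mu ≡μ push eta (dilation a) ->
  (\int[mu]_x (enorm x ^+ 2)%:E = (a ^+ 2)%:E)%E.
Proof.
by move=> muE; rewrite (integral_measure_eq _ muE) moment_dilation eta1 mule1.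
Qed.

Lemma P2_pairs_ray v a b : v ≡μ push eta (ray a b) -> P2_pairs v.
Proof.
move=> vE; rewrite /P2_pairs/= (integral_measure_eq _ vE).
rewrite integral_push; last 2 first.
- apply/measurable_EFinP; apply: measurable_funD; apply: measurable_sqnorm.
    exact: measurable_fst.
  exact: measurable_snd.
- by move=> y; rewrite lee_fin addr_ge0 ?sqr_ge0.
rewrite /ray/=.
rewrite (eq_integral (fun x => ((a ^+ 2 + b ^+ 2) * enorm x ^+ 2)%:E))//; last first.
  by move=> x _; rewrite !enormZ !exprMn !real_normK ?num_real// mulrDl.
under eq_integral do rewrite EFinM.
rewrite ge0_integralZl//.
- by rewrite eta1 mule1 ltry.
- exact: measurable_sqnorm_id.
- by move=> x _; rewrite lee_fin sqr_ge0.
- by rewrite lee_fin addr_ge0 ?sqr_ge0.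
Qed.

Lemma plans_ray mu nu pi a b :
  mu ≡μ push eta (dilation a) -> nu ≡μ push eta (dilation b) ->
  pi ≡μ push eta (ray a b) -> plans mu nu pi.
Proof.
move=> muE nuE piE; split; first exact: P2_pairs_ray piE.
- move=> A mA; rewrite (push_measure_eq pr1 piE mA) (muE _ mA); reflexivity.
- move=> A mA; rewrite (push_measure_eq pr2 piE mA) (nuE _ mA); reflexivity.
Qed.

Lemma cost_ray pi a b : pi ≡μ push eta (ray a b) -> cost pi = ((a - b) ^+ 2)%:E.
Proof.
move=> piE; rewrite /cost (integral_measure_eq _ piE) integral_push; last 2 first.
- apply/measurable_EFinP; apply: measurable_sqnorm.
  exact: measurable_subr measurable_fst measurable_snd.
- by move=> y; rewrite lee_fin sqr_ge0.
rewrite -moment_scaled; apply: eq_integral => x _.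
by rewrite /ray/= scalerBl.
Qed.

Lemma plan_expansion mu nu pi a b : 0 <= a -> 0 <= b ->
  mu ≡μ push eta (dilation a) -> nu ≡μ push eta (dilation b) ->
  plans mu nu pi -> exists2 C : R, `|C| <= a * b & forall s t : R,
    (\int[pi]_p (enorm (s *: p.1 + t *: p.2) ^+ 2)%:E =
      (s ^+ 2 * a ^+ 2 + 2 * s * t * C + t ^+ 2 * b ^+ 2)%:E)%E.
Proof.
move=> a0 b0 muE nuE [_ pi1 pi2].
apply: (L2_expansion measurable_fst measurable_snd a0 b0).
- by rewrite (moment_pr1 pi1) (moment_dilated muE).
- by rewrite (moment_pr2 pi2) (moment_dilated nuE).
Qed.

Lemma cost_expansion pi : cost pi =
  (\int[pi]_p (enorm (1 *: p.1 + (-1) *: p.2) ^+ 2)%:E)%E.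
Proof. by apply: eq_integral => p _; rewrite scale1r scaleN1r. Qed.

(** The cost is a^2 - 2 C + b^2, and C <= a b. *)
Lemma cost_ge mu nu pi a b : 0 <= a -> 0 <= b ->
  mu ≡μ push eta (dilation a) -> nu ≡μ push eta (dilation b) ->
  plans mu nu pi -> (((a - b) ^+ 2)%:E <= cost pi)%E.
Proof.
move=> a0 b0 muE nuE pip.
have [C + CE] := plan_expansion a0 b0 muE nuE pip.
rewrite cost_expansion CE lee_fin ler_norml; lra.
Qed.

Lemma W2_dilation mu nu a b : 0 <= a -> 0 <= b ->
  mu ≡μ push eta (dilation a) -> nu ≡μ push eta (dilation b) ->
  W2 mu nu = `|a - b|%:E.
Proof.
move=> a0 b0 muE nuE; rewrite /W2.
have -> : ereal_inf [set cost pi | pi in plans mu nu] = ((a - b) ^+ 2)%:E.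
  apply/eqP; rewrite eq_le; apply/andP; split.
    apply: ereal_inf_lbound; exists (push eta (ray a b)); last exact: cost_ray.
    exact: plans_ray muE nuE _.
  by apply: le_ereal_inf_tmp => _ [pi pip <-]; exact: cost_ge pip.
by rewrite poweR_EFin powR12_sqrt ?sqr_ge0// sqrtr_sqr.
Qed.

(** Comparison with the radial plan forces C = a b, the equality case of
    Cauchy-Schwarz.  The integral of |x - (a/b) y|^2 is then zero, so that the plan
    is carried by the line x = (a/b) y and determined by its second marginal. *)
Lemma opt_plan_ray mu nu pi a b : 0 <= a -> a <= b ->
  mu ≡μ push eta (dilation a) -> nu ≡μ push eta (dilation b) ->
  opt_plans mu nu pi -> pi ≡μ push eta (ray a b).
Proof.
move=> a0 ab muE nuE [pip piopt]; have b0 := le_trans a0 ab.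
have [C Cle CE] := plan_expansion a0 b0 muE nuE pip.
have := piopt _ (plans_ray muE nuE (fun A _ => erefl)).
rewrite (cost_ray (pi := push eta (ray a b)) (fun A _ => erefl)) cost_expansion CE lee_fin => Cge.
have {Cle Cge} C_eq : C = a * b by move: Cle; rewrite ler_norml; lra.
(* If b = 0 then a = 0 and k = 0, so that k * b = a still holds. *)
pose k := a / b.
have kb : k * b = a.
  have [b_eq0|b_neq0] := eqVneq b 0; last by rewrite /k divfK.
  by rewrite b_eq0 mulr0; apply/eqP; rewrite eq_le a0 -b_eq0 ab.
have : (\int[pi]_p (enorm (1 *: p.1 + (- k) *: p.2) ^+ 2)%:E = 0)%E.
  by rewrite CE C_eq -kb; congr EFin; ring.
have mline : measurable_fun setT (fun p : E * E => 1 *: p.1 + (- k) *: p.2).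
  by apply: measurable_lin; [exact: measurable_fst|exact: measurable_snd].
move=> /(L2_zero_ae mline) pi_line.
have piE : pi ≡μ push (push pi pr2) (ray k 1).
  move=> A mA; apply: (ae_eq_preimage (f := idfun) (g := ray k 1 \o pr2)) => //.
    exact: measurable_id.
  apply: filterS pi_line => -[x y]/=.
  rewrite scale1r scaleNr => /eqP; rewrite subr_eq0 => /eqP ->.
  by rewrite /ray /pr2/= scale1r.
have [_ _ pi2] := pip.
move=> A mA; rewrite (piE _ mA) (push_measure_eq (ray k 1) pi2 mA).
rewrite (push_measure_eq (ray k 1) nuE mA).
rewrite -kb /push /distribution /pushforward/=; congr (eta _).
by apply/funext => x; rewrite /preimage /ray /dilation /= !scalerA mul1r.
Qed.

End wasserstein.

Lemma le_sqrt_poweR (R : realType) (x y : \bar R) :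
  (0 <= x)%E -> (x <= y)%E -> (x `^ 2^-1 <= y `^ 2^-1)%E.
Proof.
move=> x0 xy; apply: gt0_ler_poweR => //; rewrite ?invr_ge0//.
  by rewrite in_itv/= x0 leey.
by rewrite in_itv/= leey andbT (le_trans x0).
Qed.

Lemma sqr_poweR_half (R : realType) (x : R) : ((x ^+ 2)%:E `^ 2^-1 = `|x|%:E)%E.
Proof. by rewrite poweR_EFin powR12_sqrt ?sqr_ge0// sqrtr_sqr. Qed.

(** * Velocity plans over dilations *)

Section velocities.
Context {R : realType} {n : nat}.
Local Notation E := 'rV[R]_n.
Variable eta : probability E R.
Hypothesis eta1 : (\int[eta]_x (enorm x ^+ 2)%:E = 1)%E.
Implicit Types (mu nu : probability E R) (pi v w : probability (E * E)%type R).

Lemma P2_triples_ray3 a b c : P2_triples (push eta (ray3 a b c)).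
Proof.
rewrite /P2_triples/= integral_push; last 2 first.
- apply/measurable_EFinP; apply: measurable_funD; last first.
    by apply: measurable_sqnorm; exact: measurable_snd.
  apply: measurable_funD; apply: measurable_sqnorm.
    exact: (measurableT_comp measurable_fst measurable_fst).
  exact: (measurableT_comp measurable_snd measurable_fst).
- by move=> y; rewrite lee_fin !addr_ge0 ?sqr_ge0.
rewrite (eq_integral (fun x =>
  ((a ^+ 2 + b ^+ 2 + c ^+ 2)%:E * (enorm x ^+ 2)%:E)%E)); last first.
  move=> x _; rewrite /ray3 /ray/= !enormZ !exprMn !real_normK ?num_real//.
  by rewrite -EFinM !mulrDl.
rewrite ge0_integralZl//.
- by rewrite eta1 mule1 ltry.
- exact: measurable_sqnorm_id.
- by move=> x _; rewrite lee_fin sqr_ge0.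
- by rewrite lee_fin !addr_ge0 ?sqr_ge0.
Qed.

(** The coupling is the law of (a X, b X, c X). *)
Lemma Wvel_ray_le v w a b c : v ≡μ push eta (ray a b) -> w ≡μ push eta (ray a c) ->
  (Wvel v w <= `|b - c|%:E)%E.
Proof.
move=> vE wE; rewrite -sqr_poweR_half; apply: le_sqrt_poweR.
  apply: le_ereal_inf_tmp => _ [c' _ <-].
  by apply: integral_ge0 => z _; rewrite lee_fin sqr_ge0.
apply: ereal_inf_lbound; exists (push eta (ray3 a b c)).
  split; first exact: P2_triples_ray3.
  - by move=> A mA; rewrite (vE _ mA).
  - by move=> A mA; rewrite (wE _ mA).
rewrite integral_push; last 2 first.
- apply/measurable_EFinP; apply: measurable_sqnorm; apply: measurable_subr.
    exact: (measurableT_comp measurable_snd measurable_fst).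
  exact: measurable_snd.
- by move=> z; rewrite lee_fin sqr_ge0.
rewrite -(moment_scaled eta1); apply: eq_integral => x _.
by rewrite /ray3 /ray/= scalerBl.
Qed.

Lemma Wvel_coupling v w e : (Wvel v w < e%:E)%E ->
  exists2 c : probability (E * E * E)%type R, push c pr12 ≡μ v /\ push c pr13 ≡μ w &
    (\int[c]_z (enorm (z.1.2 - z.2) ^+ 2)%:E < (e ^+ 2)%:E)%E.
Proof.
move=> vwe; have e0 : 0 <= e.
  by rewrite -lee_fin (le_trans _ (ltW vwe))// poweR_ge0.
have : (ereal_inf [set \int[a]_z (enorm (z.1.2 - z.2) ^+ 2)%:E |
    a in [set a | [/\ P2_triples a, push a pr12 ≡μ v & push a pr13 ≡μ w]]]
    < (e ^+ 2)%:E)%E.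
  rewrite ltNge; apply/negP => /le_sqrt_poweR.
  rewrite sqr_poweR_half ger0_norm// lee_fin sqr_ge0 => /(_ isT).
  by rewrite leNgt vwe.
by move=> /ereal_inf_lt[_ [c [_ c1 c2] <-]] ce; exists c.
Qed.

(** The triangle inequality in L2 for a coupling of w and v: the L2 norm of
    velocities is 1-Lipschitz for the distance of velocity plans. *)
Lemma speed_le v w m e : 0 <= m ->
  (\int[v]_p (enorm p.2 ^+ 2)%:E = (m ^+ 2)%:E)%E -> (Wvel w v < e%:E)%E ->
  exists2 m', 0 <= m' <= m + e &
    (\int[w]_p (enorm p.2 ^+ 2)%:E = (m' ^+ 2)%:E)%E.
Proof.
move=> m0 vm wve; have e0 : 0 <= e.
  by rewrite -lee_fin (le_trans _ (ltW wve))// poweR_ge0.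
have [c [c12 c13] ce] := Wvel_coupling wve.
have [D D0 cD] := L2_norm (lt_trans ce (ltry _)).
have De : D <= e.
  by move: ce; rewrite cD lte_fin => /ltW; rewrite ler_sqr.
have msq : measurable_fun setT (fun p : E * E => (enorm p.2 ^+ 2)%:E).
  by apply/measurable_EFinP; apply: measurable_sqnorm; exact: measurable_snd.
have sq0 (p : E * E) : (0 <= (enorm p.2 ^+ 2)%:E)%E by rewrite lee_fin sqr_ge0.
have cm : (\int[c]_z (enorm z.2 ^+ 2)%:E = (m ^+ 2)%:E)%E.
  by rewrite -vm -(integral_measure_eq _ c13) (integral_push c pr13 msq sq0).
have m2 : measurable_fun setT (fun z : E * E * E => z.2) by exact: measurable_snd.
have m12 : measurable_fun setT (fun z : E * E * E => z.1.2).
  exact: (measurableT_comp measurable_snd measurable_fst).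
have [C + CE] := L2_expansion m2 (measurable_subr m12 m2) m0 D0 cm cD.
rewrite ler_norml => /andP[_ Cle].
have wE : (\int[w]_p (enorm p.2 ^+ 2)%:E = (m ^+ 2 + 2 * C + D ^+ 2)%:E)%E.
  rewrite -(integral_measure_eq _ c12) (integral_push c pr12 msq sq0).
  transitivity (\int[c]_z (enorm (1 *: z.2 + 1 *: (z.1.2 - z.2)) ^+ 2)%:E)%E.
    by apply: eq_integral => z _; rewrite !scale1r subrKC.
  by rewrite CE; congr EFin; ring.
have [|m' m'0 wm'] := L2_norm (P := w) (f := snd); first by rewrite wE ltry.
exists m' => //; rewrite m'0/=.
have {wm'} : m' ^+ 2 = m ^+ 2 + 2 * C + D ^+ 2.
  by apply: EFin_inj; rewrite -wE -wm'.
move=> m'E; rewrite -ler_sqr ?nnegrE ?addr_ge0// m'E.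
have : (m + D) ^+ 2 <= (m + e) ^+ 2 by rewrite ler_sqr ?nnegrE ?addr_ge0// lerD2l.
nra.
Qed.

Lemma zero_plan_ray mu a : mu ≡μ push eta (dilation a) ->
  zero_plan mu ≡μ push eta (ray a 0).
Proof.
move=> muE A mA; rewrite /zero_plan.
have mA0 : measurable [set x : E | A (x, 0)].
  rewrite -[X in measurable X]setTI.
  by have := @pair2_measurable _ _ E E (0 : E) measurableT A mA.
transitivity (mu [set x : E | A (x, 0)]).
  transitivity (\int[mu]_x (\d_(0%R : E) (xsection A x) : \bar R))%E => //.
  rewrite (eq_integral (fun x => (\1_[set x : E | A (x, 0)] x)%:E)).
    by rewrite integral_indic// setIT.
  move=> x _; rewrite diracE indicE; congr ((nat_of_bool _)%:R%:E).
  by rewrite mem_xsection; apply/idP/idP => /set_mem ?; exact/mem_set.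
rewrite (muE _ mA0); rewrite /push /distribution /pushforward/=; congr (eta _).
apply/funext => x; change (A (a *: x, 0) = A (a *: x, 0 *: x)); by rewrite scale0r.
Qed.

Lemma curve_of_ray v a b t : v ≡μ push eta (ray a b) ->
  curve_of v t ≡μ push eta (dilation (a + t * b)).
Proof.
move=> vE A mA; rewrite (push_measure_eq (move_along t) vE mA).
rewrite /push /distribution /pushforward/=; congr (eta _).
by apply/funext => x; rewrite /preimage /ray /dilation /move_along/= scalerA -scalerDl.
Qed.

Lemma velocity_plans_ray mu v a b : mu ≡μ push eta (dilation a) ->
  v ≡μ push eta (ray a b) -> velocity_plans mu v.
Proof.
move=> muE vE; split; first exact: P2_pairs_ray vE.
by move=> A mA; rewrite (push_measure_eq pr1 vE mA) (muE _ mA).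
Qed.

Lemma geodesic_ray v a b e : 0 <= a -> 0 <= b -> v ≡μ push eta (ray a b) ->
  geodesic_on (curve_of v) e.
Proof.
move=> a0 b0 vE; exists b => // t1 t2 /andP[t10 _] /andP[t20 _].
rewrite (W2_dilation eta1 _ _ (curve_of_ray t1 vE) (curve_of_ray t2 vE))
  ?addr_ge0 ?mulr_ge0//.
by rewrite opprD addrACA subrr add0r -mulrBl normrM (ger0_norm b0) mulrC distrC.
Qed.

Lemma Wvel_ray_refl v a b e : 0 < e -> v ≡μ push eta (ray a b) -> (Wvel v v < e%:E)%E.
Proof.
by move=> e0 vE; rewrite (le_lt_trans (Wvel_ray_le vE vE))// subrr normr0 lte_fin.
Qed.

Lemma tangent_space_ray mu v a b : 0 <= a -> 0 <= b ->
  mu ≡μ push eta (dilation a) -> v ≡μ push eta (ray a b) -> tangent_space mu v.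
Proof.
move=> a0 b0 muE vE; split; first exact: velocity_plans_ray muE vE.
move=> e e0; exists v; last exact: Wvel_ray_refl vE.
split; first exact: velocity_plans_ray muE vE.
by exists 1 => //; exact: geodesic_ray vE.
Qed.

Lemma moment_pr2_ray v a b : v ≡μ push eta (ray a b) ->
  (\int[v]_p (enorm p.2 ^+ 2)%:E = (b ^+ 2)%:E)%E.
Proof.
move=> vE; have v2 : push v pr2 ≡μ push eta (dilation b).
  by move=> A mA; rewrite (push_measure_eq pr2 vE mA).
by rewrite (moment_pr2 v2) (moment_dilated eta1 (a := b) (mu := push eta (dilation b))).
Qed.

End velocities.

(** * Directional derivatives of the energy *)

Section steepest_descent.
Context {R : realType} {n : nat} (r : R) (r1 : 1 <= r) (r2 : r < 2).
Local Notation E := 'rV[R]_n.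
Local Notation EK := (interaction_energy (riesz_kernel r : E -> E -> R)).
Variable eta : probability E R.
Hypothesis eta1 : (\int[eta]_x (enorm x ^+ 2)%:E = 1)%E.
Hypothesis eta_min : forall nu, unit_second_moment nu -> (EK eta <= EK nu)%E.
Implicit Types (mu nu : probability E R) (pi u v w : probability (E * E)%type R).

Let r_gt0 : 0 < r. Proof. exact: lt_le_trans r1. Qed.
Let r_ge0 : 0 <= r. Proof. exact: ltW. Qed.
Let r_le2 : r <= 2. Proof. exact: ltW. Qed.
Let r1_ge0 : 0 <= r - 1. Proof. by rewrite subr_ge0. Qed.

Local Notation emin := (fine (EK eta)).

Lemma min_energy_fin_num : EK eta \is a fin_num.
Proof. by apply: energy_fin_num => //; rewrite /P2/= eta1 ltry. Qed.

Lemma min_energy_le0 : emin <= 0.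
Proof. by rewrite -lee_fin fineK ?min_energy_fin_num// energy_le0. Qed.

Lemma energy_dilated mu a : 0 <= a -> mu ≡μ push eta (dilation a) ->
  EK mu = (a `^ r * emin)%:E.
Proof.
move=> a0 muE; rewrite (energy_measure_eq _ muE) energy_dilation//.
by rewrite EFinM fineK// min_energy_fin_num.
Qed.

(** By Cauchy-Schwarz the second moment of [curve_of w t] is at most (a + t m)^2,
    and a larger second moment only lowers the bound because the minimal energy is
    nonpositive. *)
Lemma energy_curve_ge mu w a m t : 0 <= a -> 0 <= m -> 0 <= t ->
  mu ≡μ push eta (dilation a) -> velocity_plans mu w ->
  (\int[w]_p (enorm p.2 ^+ 2)%:E = (m ^+ 2)%:E)%E ->
  (((a + t * m) `^ r * emin)%:E <= EK (curve_of w t))%E.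
Proof.
move=> a0 m0 t0 muE [_ w1] wm.
have wa : (\int[w]_p (enorm p.1 ^+ 2)%:E = (a ^+ 2)%:E)%E.
  by rewrite (moment_pr1 w1) (moment_dilated eta1 muE).
have [C + CE] := L2_expansion (P := w) measurable_fst measurable_snd a0 m0 wa wm.
rewrite ler_norml => /andP[_ Cle].
have curveE : (\int[curve_of w t]_x (enorm x ^+ 2)%:E =
    (a ^+ 2 + 2 * t * C + t ^+ 2 * m ^+ 2)%:E)%E.
  rewrite moment_push.
  transitivity (\int[w]_p (enorm (1 *: p.1 + t *: p.2) ^+ 2)%:E)%E.
    by apply: eq_integral => p _; rewrite scale1r.
  by rewrite CE; congr EFin; ring.
have [|M M0 ME] := L2_norm (P := curve_of w t) (f := idfun); first by rewrite curveE ltry.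
have := energy_lower_bound r_gt0 eta_min min_energy_fin_num M0 ME.
apply: le_trans.
rewrite lee_fin ler_wnM2r ?min_energy_le0//.
have am0 : 0 <= a + t * m by rewrite addr_ge0// mulr_ge0.
rewrite ge0_ler_powR ?nnegrE// -ler_sqr ?nnegrE//.
have -> : M ^+ 2 = a ^+ 2 + 2 * t * C + t ^+ 2 * m ^+ 2.
  by apply: EFin_inj; rewrite -curveE -ME.
have : t * C <= t * (a * m) by rewrite ler_wpM2l.
nra.
Qed.

(** The tangent line is taken at the end point a + t m, where it bounds the
    increment of the power from above. *)
Lemma quotient_ge mu w a m t : 0 <= a -> 0 <= m -> 0 < t ->
  mu ≡μ push eta (dilation a) -> velocity_plans mu w ->
  (\int[w]_p (enorm p.2 ^+ 2)%:E = (m ^+ 2)%:E)%E ->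
  ((r * (a + t * m) `^ (r - 1) * m * emin)%:E <=
    (EK (curve_of w t) - EK mu) * (t^-1)%:E)%E.
Proof.
move=> a0 m0 t0 muE wmu wm.
have := energy_curve_ge a0 m0 (ltW t0) muE wmu wm.
rewrite (energy_dilated a0 muE) lee_pdivlMr// => curve_ge.
rewrite -EFinM leeBrDr// -EFinD; apply: le_trans curve_ge; rewrite lee_fin.
have am0 : 0 <= a + t * m by rewrite addr_ge0// mulr_ge0// ltW.
have tangent := powR_above_tangent r1 am0 a0.
have := ler_wnM2r min_energy_le0 tangent; lra.
Qed.

(** In the neighbourhood of radius d / (m + 1) of v and of t = 0, plans have speed
    at most m + d and displacement at most d. *)
Lemma Hminus_ge_near mu v a m d : 0 <= a -> 0 <= m -> 0 < d <= 1 ->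
  mu ≡μ push eta (dilation a) -> (\int[v]_p (enorm p.2 ^+ 2)%:E = (m ^+ 2)%:E)%E ->
  ((r * (a + d) `^ (r - 1) * (m + d) * emin)%:E <= Hminus EK mu v)%E.
Proof.
move=> a0 m0 /andP[d0 d1] muE vm.
pose e := d / (m + 1).
have m10 : 0 < m + 1 by rewrite ltr_wpDl.
have e_gt0 : 0 < e by rewrite divr_gt0.
have ed : e <= d by rewrite ler_pdivrMr// ler_peMr// ?lerDr// ltW.
apply: le_ereal_sup_tmp; eexists; first by exists e.
apply: le_ereal_inf_tmp => _ [w [t [wmu wv /andP[t0 te] _ ->]]].
have [m' /andP[m'0 m'le] wm'] := speed_le m0 vm wv.
apply: le_trans (quotient_ge a0 m'0 t0 muE wmu wm').
have m'd : m' <= m + d by rewrite (le_trans m'le)// lerD2l.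
have tm'd : t * m' <= d.
  rewrite (@le_trans _ _ (e * (m + 1)))//; last by rewrite /e divfK// gt_eqF.
  rewrite ler_pM ?(ltW t0) ?(ltW te)// (le_trans m'le)// lerD2l.
  exact: le_trans d1.
rewrite lee_fin ler_wnM2r ?min_energy_le0//.
rewrite ler_pM ?mulr_ge0 ?powR_ge0// ler_wpM2l//.
apply: ge0_ler_powR => //; last by rewrite lerD2l.
  by rewrite nnegrE addr_ge0// mulr_ge0// ltW.
by rewrite nnegrE addr_ge0// ltW.
Qed.

Lemma Hminus_ge mu v a m : 0 <= a -> 0 <= m -> mu ≡μ push eta (dilation a) ->
  (\int[v]_p (enorm p.2 ^+ 2)%:E = (m ^+ 2)%:E)%E ->
  ((r * a `^ (r - 1) * m * emin)%:E <= Hminus EK mu v)%E.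
Proof.
move=> a0 m0 muE vm.
have nearby d : 0 < d <= 1 -> ((r * (a + d) `^ (r - 1) * (m + d) * emin)%:E <= Hminus EK mu v)%E.
  by move=> d01; exact: Hminus_ge_near muE vm.
have d1 : 0 < (1 : R) <= 1 by rewrite ltr01 lexx.
case: (Hminus EK mu v) nearby => [h nearby|_|/(_ 1 d1)//]; last exact: leey.
rewrite lee_fin.
have cv : r * (a + d) `^ (r - 1) * (m + d) * emin @[d --> 0^'+] -->
    r * a `^ (r - 1) * (m + 0) * emin.
  apply: cvgM; last exact: cvg_cst.
  apply: cvgM; first by apply: cvgM; [exact: cvg_cst|exact: powR_cvg_right].
  by apply: cvgD; [exact: cvg_cst|exact: cvg_at_right_filter].
rewrite addr0 in cv; apply: (cvgr_to_le cv).
near=> d; rewrite -lee_fin; apply: nearby; apply/andP; split; near: d.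
  exact: nbhs_right_gt.
exact: nbhs_right_le.
Unshelve. all: by end_near. Qed.

Lemma Hminus_gtNy mu v a : 0 <= a -> mu ≡μ push eta (dilation a) ->
  P2_pairs v -> (-oo < Hminus EK mu v)%E.
Proof.
move=> a0 muE v2.
have [m m0 vm] : exists2 m : R, 0 <= m & (\int[v]_p (enorm p.2 ^+ 2)%:E = (m ^+ 2)%:E)%E.
  apply: (L2_norm (P := v) (f := snd)); apply: le_lt_trans v2.
  have msq : measurable_fun setT (fun p : E * E => enorm p.2 ^+ 2).
    by apply: measurable_sqnorm; exact: measurable_snd.
  apply: ge0_le_integral => //.
  - by move=> p _; rewrite lee_fin sqr_ge0.
  - exact/measurable_EFinP.
  - apply/measurable_EFinP; apply: measurable_funD => //.
    by apply: measurable_sqnorm; exact: measurable_fst.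
  - by move=> p _; rewrite lee_fin lerDr sqr_ge0.
exact: lt_le_trans (ltNyr _) (Hminus_ge a0 m0 muE vm).
Qed.

(** The radial plan itself is admissible in every neighbourhood of v, and along it
    the energy is exactly (a + t)^r times the minimal energy. *)
Lemma Hminus_ray_le mu v a : 0 <= a -> mu ≡μ push eta (dilation a) ->
  v ≡μ push eta (ray a 1) -> (Hminus EK mu v <= (r * a `^ (r - 1) * emin)%:E)%E.
Proof.
move=> a0 muE vE; apply: ge_ereal_sup => _ [e /= e_gt0 <-].
have t0 : 0 < e / 2 by rewrite divr_gt0.
have at0 : 0 <= a + e / 2 * 1 by rewrite addr_ge0// mulr1 ltW.
apply: ge_ereal_inf; eexists.
  exists v, (e / 2); split; [..|reflexivity].
  - exact: velocity_plans_ray muE vE.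
  - exact: Wvel_ray_refl vE.
  - by rewrite t0/= ltr_pdivrMr// ltr_pMr// ltr1n.
  - exact: geodesic_ray vE.
rewrite (energy_dilated at0 (curve_of_ray _ vE)) (energy_dilated a0 muE).
rewrite lee_pdivrMr// -EFinB -EFinM lee_fin.
have tangent := powR_above_tangent r1 a0 at0.
have := ler_wnM2r min_energy_le0 tangent; lra.
Qed.

Lemma Hminus_ray mu v a : 0 <= a -> mu ≡μ push eta (dilation a) ->
  v ≡μ push eta (ray a 1) -> Hminus EK mu v = (r * a `^ (r - 1) * emin)%:E.
Proof.
move=> a0 muE vE; apply/eqP; rewrite eq_le (Hminus_ray_le a0 muE vE)/=.
have := Hminus_ge a0 ler01 muE (moment_pr2_ray eta1 vE).
by rewrite mulr1.
Qed.

(** The null plan has speed 0 and the speed is 1-Lipschitz. *)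
Lemma unit_tangents_speed mu w a : 0 <= a -> mu ≡μ push eta (dilation a) ->
  unit_tangents mu w ->
  exists2 m, 0 <= m <= 1 & (\int[w]_p (enorm p.2 ^+ 2)%:E = (m ^+ 2)%:E)%E.
Proof.
move=> a0 muE [_ w1].
have zm := moment_pr2_ray eta1 (zero_plan_ray muE).
have small e : 1 < e -> exists2 m, 0 <= m <= 0 + e &
    (\int[w]_p (enorm p.2 ^+ 2)%:E = (m ^+ 2)%:E)%E.
  by move=> e1; apply: speed_le zm _ => //; rewrite w1 lte_fin.
have [m /andP[m0 _] wm] := small 2 (ltr1n _ _).
exists m => //; rewrite m0/=; apply/ler_addgt0Pr => e e_gt0.
have [|m' /andP[m'0 m'le] wm'] := small (1 + e); first by rewrite ltrDl.
have -> : m = m'.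
  apply/eqP; rewrite -(eqrXn2 (n := 2))//.
  by apply/eqP/EFin_inj; rewrite -wm -wm'.
by rewrite add0r in m'le.
Qed.

Lemma unit_tangents_ray mu v a : 0 <= a -> mu ≡μ push eta (dilation a) ->
  v ≡μ push eta (ray a 1) -> unit_tangents mu v.
Proof.
move=> a0 muE vE; have zE := zero_plan_ray muE; split.
  exact: tangent_space_ray muE vE.
apply/eqP; rewrite eq_le; apply/andP; split.
  by have := Wvel_ray_le eta1 vE zE; rewrite subr0 normr1.
rewrite leNgt; apply/negP => lt1.
have [e ve e1] : exists2 e : R, (Wvel v (zero_plan mu) < e%:E)%E & e < 1.
  have v0 : (0 <= Wvel v (zero_plan mu))%E by exact: poweR_ge0.
  move: lt1 v0; case: (Wvel _ _) => [x|//|//]; rewrite lte_fin => x1 _.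
  by exists ((x + 1) / 2); rewrite ?lte_fin; lra.
have [m /andP[m0 me]] := speed_le (lexx 0) (moment_pr2_ray eta1 zE) ve.
rewrite (moment_pr2_ray eta1 vE) => -[]/eqP; rewrite eq_sym eqrXn2// => /eqP m1.
by move: me; rewrite add0r m1 leNgt e1.
Qed.

(** Among speeds m <= 1 the lower bound of [Hminus_ge] is smallest at m = 1, where the
    radial plan attains it. *)
Lemma steepest_directions_ray mu u a : 0 <= a -> mu ≡μ push eta (dilation a) ->
  u ≡μ push eta (ray a (- (r * a `^ (r - 1) * emin))) -> steepest_directions EK mu u.
Proof.
move=> a0 muE uE; split.
- by rewrite (energy_dilated a0 muE) ltry.
- by move=> v [[v2 _] _]; exact: Hminus_gtNy muE v2.
pose v := push eta (ray a 1).
have vE : v ≡μ push eta (ray a 1) by [].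
exists v; split; first exact: unit_tangents_ray a0 muE vE.
  move=> w /(unit_tangents_speed a0 muE)[m /andP[m0 m1] wm].
  rewrite (Hminus_ray a0 muE vE) (le_trans _ (Hminus_ge a0 m0 muE wm))// lee_fin.
  by rewrite ler_wnM2r ?min_energy_le0// ler_piMr// mulr_ge0// powR_ge0.
rewrite (Hminus_ray a0 muE vE).
have -> : neg_part (r * a `^ (r - 1) * emin)%:E = - (r * a `^ (r - 1) * emin).
  rewrite /neg_part -EFinN -EFin_max/=; apply/max_idPl.
  by rewrite oppr_ge0 mulr_ge0_le0 ?min_energy_le0// mulr_ge0// powR_ge0.
move=> A mA; rewrite (uE _ mA).
rewrite /scale_plan /push /distribution /pushforward/=; congr (eta _).
apply/funext => x; rewrite /preimage /ray /scale_velocity/=.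
by rewrite scale1r.
Qed.

End steepest_descent.

(** * Dilation curves and the flow *)

Section power_growth.
Context {R : realType} (p k : R) (p1 : 1 <= p) (k0 : 0 <= k).
Implicit Types s t h : R.

Let f t := k * t `^ p.
Let f' t := p * k * t `^ (p - 1).

Lemma scaled_power_slope s t : 0 <= s -> s <= t ->
  f' s * (t - s) <= f t - f s <= f' t * (t - s).
Proof.
move=> s0 st; have t0 := le_trans s0 st; rewrite /f /f'.
have := ler_wpM2l k0 (powR_above_tangent p1 s0 t0).
have := ler_wpM2l k0 (powR_above_tangent p1 t0 s0).
by move=> *; apply/andP; split; lra.
Qed.

Lemma scaled_power_right_derivative t : 0 <= t ->
  (f (t + h) - f t) / h @[h --> 0^'+] --> f' t.
Proof.
move=> t0; apply: (@squeeze_cvgr _ _ _ _ (fun=> f' t) (fun h => f' (t + h))).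
- near=> h; have h0 : 0 < h by near: h; exact: nbhs_right_gt.
  have /andP[lo hi] : f' t * h <= f (t + h) - f t <= f' (t + h) * h.
    have := @scaled_power_slope t (t + h) t0.
    by rewrite lerDl ltW// => /(_ isT); rewrite addrAC subrr add0r.
  by rewrite ler_pdivlMr// ler_pdivrMr// lo.
- exact: cvg_cst.
- apply: cvgM; first exact: cvg_cst.
  by apply: powR_cvg_right => //; rewrite subr_ge0.
Unshelve. all: by end_near. Qed.

End power_growth.

Section dilation_curves.
Context {R : realType} {n : nat}.
Local Notation E := 'rV[R]_n.
Variable eta : probability E R.
Hypothesis eta1 : (\int[eta]_x (enorm x ^+ 2)%:E = 1)%E.
Variable alpha : R -> R.
Hypothesis alpha_ge0 : forall t, 0 <= t -> 0 <= alpha t.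
Hypothesis alpha_mono : forall s t, 0 <= s -> s <= t -> alpha s <= alpha t.

Let gamma t := push eta (dilation (alpha t)).

Lemma dilation_curve_lac :
  (forall b, 0 <= b -> exists2 L, 0 <= L & forall s t, 0 <= s -> s <= t -> t <= b ->
    alpha t - alpha s <= L * (t - s)) ->
  locally_absolutely_continuous gamma.
Proof.
move=> lip a b a0 ab; have [L L0 aL] := lip b (le_trans a0 ab).
exists (fun=> L).
  apply/integrableP; split; first exact: measurable_cst.
  under eq_integral do rewrite gee0_abs ?lee_fin//.
  rewrite integral_cst//= lebesgue_measure_itv/=.
  by case: ifPn => _; rewrite ?mule0// -EFinB -EFinM ltry.
move=> s t sa st tb; have s0 := le_trans a0 sa.
rewrite (@W2_dilation _ _ _ eta1 (gamma s) (gamma t) (alpha s) (alpha t))//;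
  [|exact: alpha_ge0|by apply: alpha_ge0; exact: le_trans st].
rewrite distrC ger0_norm ?subr_ge0 ?alpha_mono//.
rewrite integral_cst//= lebesgue_measure_itv/= lte_fin.
have := aL s t s0 st tb; case: ltP => [_|ts]; first by rewrite -EFinB -EFinM lee_fin.
have -> : t = s by apply/eqP; rewrite eq_le ts st.
by rewrite !subrr mulr0 mule0 lee_fin.
Qed.

(** The optimal plan from time t to t + h is unique and radial, so that the rescaled
    displacement is the radial plan with the difference quotient of alpha as its
    velocity factor. *)
Lemma dilation_curve_tangent t (a' : R) (v : probability (E * E)%type R) : 0 <= t -> 0 <= a' ->
  (alpha (t + h) - alpha t) / h @[h --> 0^'+] --> a' ->
  v ≡μ push eta (ray (alpha t) a') -> tangent_vector gamma t v.
Proof.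
move=> t0 a'0 da vE; split; first exact: (tangent_space_ray eta1 (alpha_ge0 t0) a'0 _ vE).
move=> vh vhE.
have bound h : 0 < h -> (Wvel v (scale_plan h^-1 (vh h)) <=
    `|a' - (alpha (t + h) - alpha t) / h|%:E)%E.
  move=> h0; have [pi piopt vhpi] := vhE h h0.
  apply: (Wvel_ray_le eta1 vE).
  have th : t <= t + h by rewrite lerDl ltW.
  have piE := opt_plan_ray eta1 (alpha_ge0 t0) (alpha_mono t0 th)
    (fun A _ => erefl) (fun A _ => erefl) piopt.
  move=> A mA; rewrite (push_measure_eq (scale_velocity h^-1) vhpi mA).
  rewrite (push_measure_eq (scale_velocity h^-1)
    (push_measure_eq displacement piE) mA).
  rewrite /push /distribution /pushforward/=; congr (eta _); apply/funext => x.
  rewrite /preimage /ray /scale_velocity /displacement/=.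
  by rewrite -scalerBl scalerA mulrC.
have bound0 : `|a' - (alpha (t + h) - alpha t) / h|%:E @[h --> 0^'+] --> 0%:E.
  apply: cvg_EFin; first by near=> h.
  have : `|a' - (alpha (t + h) - alpha t) / h| @[h --> 0^'+] --> `|a' - a'|.
    by apply: cvg_norm; apply: cvgB; [exact: cvg_cst|exact: da].
  by rewrite subrr normr0.
apply: (squeeze_cvge _ (cvg_cst 0%E) bound0).
near=> h; rewrite poweR_ge0/=; apply: bound.
by near: h; exact: nbhs_right_gt.
Unshelve. all: by end_near. Qed.

End dilation_curves.

Theorem theorem21 (R : realType) (d : nat) (r : R) (hr : 1 <= r < 2)
    (eta : probability 'rV[R]_d R)
    (heta : unique_minimizer (interaction_energy (riesz_kernel r))
              unit_second_moment eta) :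
  let EK := interaction_energy (riesz_kernel r) in
  let alpha := fun t : R =>
    (- t * r * (2 - r) * fine (EK eta)) `^ (1 / (2 - r)) in
  let gamma := fun t : R => push eta (dilation (alpha t)) in
  steepest_descent_flow EK gamma /\ gamma 0 ≡μ \d_(0 : 'rV[R]_d).
Proof.
move=> EK alpha gamma.
have /andP[r1 r2] := hr; have [[_ eta1] eta_min _] := heta.
have e_le0 : fine (EK eta) <= 0 := min_energy_le0 r1 r2 eta1.
pose p := 1 / (2 - r); pose c := - (r * (2 - r) * fine (EK eta)).
have r2' : 0 < 2 - r by rewrite subr_gt0.
have p1 : 1 <= p by rewrite /p ler_pdivlMr// mul1r lerBlDr -lerBlDl; lra.
have p0 : 0 < p by rewrite (lt_le_trans ltr01).
have c0 : 0 <= c by rewrite oppr_ge0 mulr_ge0_le0// mulr_ge0; lra.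
pose k := c `^ p; have k0 : 0 <= k by exact: powR_ge0.
have alphaE t : 0 <= t -> alpha t = k * t `^ p.
  by move=> t0; rewrite -powRM//; congr (_ `^ _); rewrite /c; ring.
pose a' t := p * k * t `^ (p - 1).
have a'0 t : 0 <= a' t by rewrite mulr_ge0 ?powR_ge0// mulr_ge0// ltW.
have alpha_ge0 t : 0 <= t -> 0 <= alpha t by move=> _; exact: powR_ge0.
have slope s t : 0 <= s -> s <= t ->
    a' s * (t - s) <= alpha t - alpha s <= a' t * (t - s).
  move=> s0 st; rewrite !alphaE// ?(le_trans s0)//.
  exact: scaled_power_slope.
have alpha_mono s t : 0 <= s -> s <= t -> alpha s <= alpha t.
  move=> s0 st; have /andP[slope_ge _] := slope s t s0 st.
  by rewrite -subr_ge0 (le_trans _ slope_ge)// mulr_ge0// subr_ge0.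
(* The differential equation satisfied by alpha.  It rests on p (r - 1) = p - 1 and
   holds at t = 0 too, with 0^0 = 1 when r = 1. *)
have a'E t : 0 <= t -> a' t = - (r * alpha t `^ (r - 1) * fine (EK eta)).
  move=> t0; rewrite alphaE// powRM ?powR_ge0// /k -!powRrM.
  have -> : p * (r - 1) = p - 1 by rewrite /p; field; rewrite gt_eqF.
  rewrite /a' /k -(mulr_powRB1 c0 p0).
  have -> : p * (c * c `^ (p - 1)) * t `^ (p - 1) =
    (p * c) * (c `^ (p - 1) * t `^ (p - 1)) by ring.
  have -> : p * c = - (r * fine (EK eta)) by rewrite /p /c; field; rewrite gt_eqF.
  by ring.
split; last first.
  move=> A mA; have -> : gamma 0 = push eta (dilation 0).
    by rewrite /gamma /alpha oppr0 !mul0r powR0// gt_eqF.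
  transitivity (eta [set _ : 'rV[R]_d | A 0]).
    congr (eta _); apply/funext => x.
    by change (A (0 *: x) = A 0); rewrite scale0r.
  change (eta [set _ : 'rV[R]_d | A 0] = (\1_A (0 : 'rV[R]_d))%:E).
  rewrite indicE; have [A0|A0] := pselect (A 0).
    have -> : [set _ : 'rV[R]_d | A 0] = setT by apply/seteqP; split.
    by rewrite mem_set// probability_setT.
  have -> : [set _ : 'rV[R]_d | A 0] = set0 by apply/seteqP; split.
  by rewrite memNset// measure0.
split.
- by move=> t t0; rewrite /P2/= moment_dilation eta1 mule1 ltry.
- apply: (dilation_curve_lac eta1 alpha_ge0 alpha_mono) => b b0.
  exists (a' b) => // s t s0 st tb; have /andP[_ le_slope] := slope s t s0 st.
  apply: le_trans le_slope _; rewrite ler_wpM2r ?subr_ge0//.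
  have t0 := le_trans s0 st.
  apply: ler_wpM2l; first by rewrite mulr_ge0// ltW.
  by apply: ge0_ler_powR; rewrite ?nnegrE ?subr_ge0.
- move=> t t0; exists (push eta (ray (alpha t) (a' t))).
    apply: (dilation_curve_tangent eta1 alpha_ge0 alpha_mono t0 (a'0 t)) => //.
    apply: cvg_trans (scaled_power_right_derivative p1 k0 t0).
    apply: near_eq_cvg; near=> h.
    have h0 : 0 <= h by near: h; exact: nbhs_right_ge.
    by rewrite !alphaE// addr_ge0.
  apply: (steepest_directions_ray r1 r2 eta1 eta_min (alpha_ge0 t t0)) => //.
  by rewrite a'E.
Unshelve. all: by end_near. Qed.
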